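(* For any integer $n \ge 2$, \[ \sum_{\lambda \in OP(n)} \dim \psi_{S_n}^\lambda = \sum_{\lambda \in EP(n)} \dim \psi_{S_n}^\lambda = \begin{cases} (n-1)!!^2, & \text{if } n \text{ is even;} \\ n!! \cdot (n-2)!!, & \text{if } n \text{ is odd.} \end{cases} \]
   Context: For a positive odd integer $m$, $m!! := m(m-2)(m-4)\cdots 1$; $(n-1)!!^2$ means $((n-1)!!)^2$. $\dim\psi$ is the degree $\psi(1)$ of a character $\psi$. $OP(n)$ is the set of all partitions of $n$ with odd parts only. For $n$ even, $EP(n)$ is the set of all partitions of $n$ with even parts only; for $n$ odd, $EP(n)$ is the set of all partitions of $n$ with all parts even except for a single part of size $1$. Higher Lie characters of $S_n$: let $\lambda \vdash n$ have $a_i$ parts of size $i$ ($i\ge 1$), and let $x \in S_n$ have cycle type $\lambda$. Write $x=\prod_i x_i$ where $x_i$ is the product of the $a_i$ cycles of $x$ of length $i$. The centralizer is $Z_x = Z_{S_n}(x) = \prod_i Z_{S_{ia_i}}(x_i) \cong \prod_i G_i \wr S_{a_i}$, with $G_i$ cyclic of order $i$. Concretely, label the $ia_i$ points lying in cycles of length $i$ by $(r,t)$, $1\le r\le a_i$, $t \in \mathbb{Z}/i\mathbb{Z}$, so that $x(r,t)=(r,t+1)$; every element $z_i\in Z_{S_{ia_i}}(x_i)$ has the form $z_i(r,t)=(\sigma(r),t+k_r)$ with $\sigma\in S_{a_i}$, $k_r\in\mathbb{Z}/i\mathbb{Z}$. Let $\omega_i$ be the linear character that is a primitive (faithful) irreducible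 character on the cyclic group $G_i$ and trivial on $S_{a_i}$, i.e. $\omega_i(z_i)=\prod_r \zeta_i^{k_r}$ with $\zeta_i$ a primitive complex $i$-th root of unity. Let $\omega^x := \bigotimes_i \omega_i$, a linear character of $Z_x$. The higher Lie character is the induced character $\psi_{S_n}^\lambda = \psi_{S_n}^x := \omega^x\uparrow_{Z_x}^{S_n}$; it depends only on $\lambda$. *)

(* Defs.v *)
From HB Require Import structures.
From mathcomp Require Import all_boot all_order all_fingroup all_algebra.
From mathcomp Require Import all_solvable all_field all_character.

Set Implicit Arguments.
Unset Strict Implicit.
Unset Printing Implicit Defensive.

Import GroupScope GRing.Theory.
Local Open Scope ring_scope.

(* m!! for odd m; the value at even m is not used. *)
Fixpoint dfact (m : nat) : nat :=
  if m is m'.+2 then (m * dfact m')%N else 1%N.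

Definition is_intpart (n : nat) (s : seq nat) : bool :=
  [&& sorted geq s, 0%N \notin s & sumn s == n].

Record intpart (n : nat) : Type :=
  IntPart { parts :> seq nat; partsP : is_intpart n parts }.

HB.instance Definition _ n := [isSub for @parts n].
HB.instance Definition _ n := [Countable of intpart n by <:].

Lemma leq_sumn (s : seq nat) (i : nat) : i \in s -> (i <= sumn s)%N.
Proof.
elim: s => //= a s IHs; rewrite inE => /orP[/eqP-> | /IHs]; first exact: leq_addr.
by move/leq_trans; apply; apply: leq_addl.
Qed.

Lemma size_leq_sumn (s : seq nat) : 0%N \notin s -> (size s <= sumn s)%N.
Proof.
elim: s => //= a s IHs; rewrite inE negb_or eq_sym -lt0n => /andP[a_gt0 /IHs].
by move=> le_s; rewrite -add1n leq_add.
Qed.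

Lemma intpart_sizeP n (lam : intpart n) :
  (size [seq inord i : 'I_n.+1 | i <- lam] <= n)%N.
Proof.
case: lam => s /= /and3P[_ s0 /eqP ds].
by rewrite size_map -[leqRHS]ds size_leq_sumn.
Qed.

Definition bseq_of_intpart n (lam : intpart n) : n.-bseq 'I_n.+1 :=
  Bseq (intpart_sizeP lam).

Definition intpart_of_bseq n (b : n.-bseq 'I_n.+1) : option (intpart n) :=
  insub [seq val i | i <- b].

Lemma bseq_of_intpartK n : pcancel (@bseq_of_intpart n) (@intpart_of_bseq n).
Proof.
move=> lam; rewrite /intpart_of_bseq /= -map_comp map_id_in ?valK // => i lam_i.
rewrite /= inordK // ltnS; have /and3P[_ _ /eqP ds] := partsP lam.
by rewrite -[leqRHS]ds leq_sumn.
Qed.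

HB.instance Definition _ n : isFinite (intpart n) :=
  PCanIsFinite (@bseq_of_intpartK n).

Definition OP (n : nat) : {set intpart n} :=
  [set lam : intpart n | all odd lam].

Definition EP (n : nat) : {set intpart n} :=
  [set lam : intpart n |
    if odd n
    then (count_mem 1%N lam == 1%N) &&
         all [pred i : nat | (i == 1%N) || ~~ odd i] lam
    else all [pred i : nat | ~~ odd i] lam].

Definition cycle_type (n : nat) (x : 'S_n) : seq nat :=
  sort geq [seq #|pred_of_set c| | c in porbits x].

Section CycleTypeOnto.

Variables (n : nat) (bs : seq (seq 'I_n)).
Hypotheses (bs0 : [::] \notin bs) (Ubs : uniq (flatten bs)).
Hypothesis bsT : forall p, p \in flatten bs.

Let blk p := nth [::] bs (find (fun b : seq 'I_n => p \in b) bs).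

Let has_blk p : has (fun b : seq 'I_n => p \in b) bs.
Proof. by have /flattenP[b bs_b b_p] := bsT p; apply/hasP; exists b. Qed.

Let blk_bs p : blk p \in bs.
Proof. by rewrite mem_nth // -has_find. Qed.

Let mem_blk p : p \in blk p.
Proof. by rewrite /blk; apply: (nth_find [::] (has_blk p)). Qed.

Lemma flatten_block_inj (ss : seq (seq 'I_n)) b c p :
  uniq (flatten ss) -> b \in ss -> c \in ss -> p \in b -> p \in c -> b = c.
Proof.
elim: ss => //= a ss IHss; rewrite cat_uniq => /and3P[_ /hasPn aN Uss].
have disj d : d \in ss -> p \in d -> p \notin a.
  by move=> ss_d d_p; apply: aN; apply/flattenP; exists d.
rewrite !inE => /orP[/eqP-> | ss_b] /orP[/eqP-> | ss_c] // b_p c_p.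
- by have := disj _ ss_c c_p; rewrite b_p.
- by have := disj _ ss_b b_p; rewrite c_p.
exact: IHss.
Qed.

Let blk_eq b p : b \in bs -> p \in b -> blk p = b.
Proof.
by move=> bs_b b_p; apply: (@flatten_block_inj bs _ _ p).
Qed.

Let U_b b : b \in bs -> uniq b.
Proof.
move=> bs_b; have := Ubs; elim: (bs) bs_b => //= a ss IHss.
by rewrite inE cat_uniq => /orP[/eqP-> | /IHss IH] /and3P[// _ _ /IH].
Qed.

Let f p := next (blk p) p.

Let f_inj : injective f.
Proof.
move=> p q eqf.
have fin r : f r \in blk r by rewrite /f mem_next.
have Eb : blk p = blk q.
  rewrite -(blk_eq (blk_bs p) (fin p)) eqf; exact: blk_eq (blk_bs q) (fin q).
have := congr1 (prev (blk p)) eqf; rewrite {2}Eb /f !prev_next //; exact: U_b.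
Qed.

Lemma exists_block_perm :
  exists x : 'S_n, perm_eq [seq #|pred_of_set c| | c in porbits x]
                           [seq size b | b <- bs].
Proof.
exists (perm f_inj); set x := perm _.
have fcyc b : b \in bs -> fcycle x b.
  move=> bs_b; have := cycle_next (U_b bs_b).
  apply: (@sub_in_cycle _ [in b]); last exact/allP.
  by move=> p r b_p _; rewrite /= permE /f (blk_eq bs_b).
have porbE b p : b \in bs -> p \in b -> porbit x p = [set q in b].
  move=> bs_b b_p; apply/setP=> q.
  rewrite inE -(fconnect_cycle (fcyc b bs_b) b_p).
  apply/porbitP/idP => [[i ->] | /iter_findex <-].
    by rewrite permX fconnect_iter.
  by exists (findex x p q); rewrite permX.
have Emap : [seq size b | b <- bs] =
            map (fun c : {set 'I_n} => #|c|) [seq [set q in b] | b <- bs].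
  rewrite -map_comp; apply/eq_in_map => b bs_b /=.
  by rewrite cardsE; apply/esym/card_uniqP/U_b.
rewrite Emap; apply: perm_map; apply: uniq_perm; first exact: enum_uniq.
  rewrite map_inj_in_uniq.
    have := Ubs; have := bs0; elim: (bs) => //= a ss IHss.
    rewrite inE cat_uniq negb_or => /andP[a0 ss0] /and3P[_ aN Uss].
    rewrite IHss // andbT; apply: contra aN => ss_a; apply/hasP.
    case: a a0 ss_a => // p a _ ss_a; exists p; last exact: mem_head.
    by apply/flattenP; exists (p :: a) => //; apply: mem_head.
  move=> [|p b] c bs_b bs_c; first by move: bs0; rewrite bs_b.
  move/setP/(_ p); rewrite !inE eqxx /= => /esym c_p.
  by rewrite -(blk_eq bs_b (mem_head p b)) (blk_eq bs_c c_p).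
move=> c; rewrite mem_enum; apply/imsetP/mapP => [[p _ ->] | [b bs_b ->]].
  by exists (blk p) => //; apply: porbE.
case: b bs_b => [|p b] bs_b; first by move: bs0; rewrite bs_b.
by exists p => //; rewrite (porbE _ _ bs_b) ?mem_head.
Qed.

End CycleTypeOnto.

Lemma cycle_type_onto n (lam : intpart n) :
  exists x : 'S_n, cycle_type x == lam :> seq nat.
Proof.
case: lam => s /= /and3P[s_sort s0 /eqP ds].
pose bs := reshape s (enum 'I_n).
have sz : sumn s = size (enum 'I_n) by rewrite size_enum_ord.
have shp : [seq size b | b <- bs] = s by apply: reshapeKl; rewrite sz.
have fl : flatten bs = enum 'I_n by rewrite reshapeKr // sz.
have [||p|x xP] := @exists_block_perm n bs.
- by apply: contra s0 => bs0; rewrite -shp; apply/mapP; exists [::].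
- by rewrite fl enum_uniq.
- by rewrite fl mem_enum.
exists x; apply/eqP; apply: (@sorted_eq _ geq).
- by move=> a b c ba ac; apply: leq_trans ac ba.
- by move=> a b; rewrite andbC => /anti_leq.
- by apply: sort_sorted => a b; apply: leq_total.
- exact: s_sort.
by rewrite /cycle_type perm_sort -shp.
Qed.

Definition perm_of_intpart n (lam : intpart n) : 'S_n :=
  xchoose (cycle_type_onto lam).

Lemma cycle_type_perm_of_intpart n (lam : intpart n) :
  cycle_type (perm_of_intpart lam) = lam.
Proof. exact/eqP/(xchooseP (cycle_type_onto lam)). Qed.

Section Omega.

Variable zeta : nat -> algC.
Hypothesis zetaP : forall i, (0 < i)%N -> i.-primitive_root (zeta i).

Section FixedPerm.

Variables (n : nat) (x : 'S_n).

(* Each cycle of x is named by its canonical point r = froot x r, labelled    *)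
(* (r, 0); a point p is then labelled (froot x p, findex x (froot x p) p).     *)
(* For z in 'C[x], with z (r, 0) = (sigma r, k_r), the exponent below is k_r,  *)
(* and the product of the omega_i over all lengths i becomes a single product  *)
(* over the cycles of x, the cycle of r having length i = #|porbit x r|.       *)
Definition omega_fun (z : 'S_n) : algC :=
  \prod_(r | r \in froots x)
    zeta #|porbit x r| ^+ findex x (froot x (z r)) (z r).

Let phi (p : 'I_n) := zeta #|porbit x p| ^+ findex x (froot x p) p.

Let xI : injective x := perm_inj.
Let symx : connect_sym (frel x) := fconnect_sym xI.

Let porbit_fconnect p q : (q \in porbit x p) = fconnect x p q.
Proof.
apply/porbitP/idP => [[i ->] | /iter_findex <-].
  by rewrite permX fconnect_iter.
by exists (findex x p q); rewrite permX.
Qed.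

Let card_porbit p : #|porbit x p| = fingraph.order x p.
Proof. by apply: eq_card => q; rewrite porbit_fconnect. Qed.

Let porbitx p : porbit x (x p) = porbit x p.
Proof. by have := porbit_perm x 1 p; rewrite expg1. Qed.

Let prim p : #|porbit x p|.-primitive_root (zeta #|porbit x p|).
Proof. by rewrite zetaP // lt0n card_porbit_neq0. Qed.

Let phi_neq0 p : phi p != 0.
Proof.
rewrite expf_neq0 //; apply/eqP=> z0; have := prim_expr_order (prim p).
rewrite z0 expr0n (negPf (card_porbit_neq0 x p)) => /esym/eqP.
by rewrite oner_eq0.
Qed.

Let phiS p : phi (x p) = zeta #|porbit x p| * phi p.
Proof.
rewrite /phi porbitx -exprS.
have <- : froot x p = froot x (x p) by apply/eqP; rewrite root_connect // fconnect1.
set r := froot x p.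
have rp : fconnect x r p by rewrite symx connect_root.
have ltk := findex_max rp; have itk := iter_findex rp.
move: ltk itk; set k := findex x r p => ltk itk.
have xpE : x p = iter k.+1 x r by rewrite iterS itk.
have ordE : fingraph.order x r = #|porbit x p|.
  rewrite -card_porbit; congr #|pred_of_set _|; apply/eqP.
  by rewrite eq_porbit_mem porbit_fconnect symx.
rewrite xpE; case: (ltngtP k.+1 (fingraph.order x r)) => [lt1 | | eq1].
- by rewrite findex_iter.
- by rewrite ltnNge ltk.
by rewrite eq1 iter_order // findex0 expr0 ordE prim_expr_order.
Qed.

Let phi_root r : r \in froots x -> phi r = 1.
Proof. by move/eqP => xr; rewrite /phi xr findex0 expr0. Qed.

Let centE z p : z \in 'C[x]%g -> z (x p) = x (z p).
Proof. by move/cent1P=> cxz; rewrite -!permM cxz. Qed.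

Let cent_iter z i p : z \in 'C[x]%g -> z (iter i x p) = iter i x (z p).
Proof. by move=> cz; elim: i => //= i <-; rewrite centE. Qed.

Let cent_connect z p q :
  z \in 'C[x]%g -> fconnect x p q -> fconnect x (z p) (z q).
Proof. by move=> cz /iter_findex <-; rewrite cent_iter // fconnect_iter. Qed.

Let cent_card z p : z \in 'C[x]%g -> #|porbit x (z p)| = #|porbit x p|.
Proof.
move=> cz; rewrite -(card_imset (mem (porbit x p)) (@perm_inj _ z)).
apply: eq_card => q; rewrite porbit_fconnect; apply/idP/imsetP.
  move/iter_findex <-; exists (iter (findex x (z p) q) x p).
    by rewrite porbit_fconnect fconnect_iter.
  by rewrite cent_iter.
by case=> s; rewrite porbit_fconnect => ps ->; apply: cent_connect.
Qed.

Let q z p := phi (z p) / phi p.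

Let qx z p : z \in 'C[x]%g -> q z (x p) = q z p.
Proof.
move=> cz; rewrite /q centE // !phiS cent_card // -mulf_div divff ?mul1r //.
apply/eqP=> z0; have := phi_neq0 (x p); rewrite phiS z0 mul0r eqxx //.
Qed.

Let q_root z p : z \in 'C[x]%g -> q z p = q z (froot x p).
Proof.
move=> cz; set r := froot x p.
have /iter_findex <- : fconnect x r p by rewrite symx connect_root.
by elim: (findex _ _ _) => //= i <-; rewrite qx.
Qed.

Let omega_fun_q z : z \in 'C[x]%g -> omega_fun z = \prod_(r | r \in froots x) q z r.
Proof.
move=> cz; apply: eq_bigr => r xr.
by rewrite /q (phi_root xr) divr1 /phi cent_card.
Qed.

Lemma omega_funM : {in 'C[x]%g &, {morph omega_fun : y z / (y * z)%g >-> y * z}}.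
Proof.
move=> y z cy cz; rewrite !omega_fun_q ?groupM // mulrC.
have -> : \prod_(r | r \in froots x) q (y * z)%g r =
          \prod_(r | r \in froots x) (q z (y r) * q y r).
  apply: eq_bigr => r _; rewrite /q permM mulrA mulfVK //.
rewrite big_split /=; congr (_ * _).
have cV : y^-1%g \in 'C[x]%g by rewrite groupV.
have key w s : w \in 'C[x]%g -> s \in froots x ->
    froot x ((w^-1)%g (froot x (w s))) = s.
  move=> cw /eqP xs; rewrite -[RHS]xs; apply/eqP; rewrite root_connect //.
  rewrite -[X in fconnect x _ X](permK w); apply: cent_connect; first by rewrite groupV.
  by rewrite symx connect_root.
rewrite [RHS](reindex_onto (fun r => froot x (y r))
                           (fun r => froot x ((y^-1)%g r))) /=.
  apply: eq_big => [r | r xr]; last exact: q_root.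
  apply/idP/andP => [xr | [_ /eqP<-]]; last exact: roots_root.
  by split; [apply: roots_root | apply/eqP/key].
by move=> r xr; have := key _ _ cV xr; rewrite invgK.
Qed.

Lemma omega_fun1 : omega_fun 1%g = 1.
Proof.
by apply: big1 => r /eqP xr; rewrite perm1 xr findex0 expr0.
Qed.

Fact omega_subproof :
  is_class_fun <<'C[x]%g>> [ffun z => if z \in 'C[x]%g then omega_fun z else 0].
Proof.
rewrite genGid; apply: intro_class_fun => [y z cy cz | y /negbTE-> //].
rewrite groupJ // cy conjgE !omega_funM ?groupM ?groupV // mulrCA.
by rewrite -omega_funM ?groupV // mulVg omega_fun1 mulr1.
Qed.

Definition omega : 'CF('C[x]%g) := Cfun 0 omega_subproof.

Lemma omegaE z : z \in 'C[x]%g -> omega z = omega_fun z.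
Proof. by move=> cz; rewrite cfunE cz. Qed.

Lemma omega_lin_char : omega \is a linear_char.
Proof.
have repP : mx_repr 'C[x]%g (fun z => (omega z)%:M : 'M_1).
  split=> [|y z cy cz]; first by rewrite omegaE ?group1 // omega_fun1.
  by rewrite !omegaE ?groupM // omega_funM // scalar_mxM.
have -> : omega = cfRepr (MxRepresentation repP).
  by apply/cfun_inP=> z cz; rewrite [RHS]cfunE cz mulr1n mxtrace_scalar mulr1n.
by apply/andP; split; [apply: cfRepr_char | rewrite cfRepr1].
Qed.

End FixedPerm.

Definition higherLie_perm n (x : 'S_n) : 'CF([set: 'S_n]) :=
  'Ind[[set: 'S_n]] (omega x).

Definition higherLie n (lam : intpart n) : 'CF([set: 'S_n]) :=
  higherLie_perm (perm_of_intpart lam).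

End Omega.

(* Main.v *)
(** The degree of [psi^lambda] is the index of the centralizer, that is, the
    size of the conjugacy class of permutations of cycle type [lambda], so both
    sums count permutations with prescribed parities of cycle lengths. Inserting
    a point [a] just after [j] in a permutation of [S \ {a}] flips the parity of
    the length of one cycle. Inserting two points one after the other gives, for
    the number [o n] of permutations with only odd cycles and the number [e n]
    of those with only even cycles,
      [o (n + 2) = o (n + 1) + (n + 1) n o n] and [e (n + 2) = (n + 1)^2 e n],
    whose solutions are the stated double factorials. For [n] odd, a permutation
    counted on the even side is a fixed point, chosen in [n] ways, together with
    a permutation of the [n - 1] other points with only even cycles. *)
Require Import Defs.
From mathcomp Require Import all_boot all_order all_fingroup all_algebra.
From mathcomp Require Import all_solvable all_field all_character.
From mathcomp Require Import zify.

Set Implicit Arguments.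
Unset Strict Implicit.
Unset Printing Implicit Defensive.

(** Rearranging the enumeration of [B] so that its values line up with those of [A], then pairing by
    position, gives [h]. It serves to match cycles of equal length in two permutations. *)
Lemma perm_eq_matching (T U : finType) (A : {set T}) (B : {set U})
    (f : T -> nat) (g : U -> nat) (u0 : U) :
  perm_eq [seq f t | t in A] [seq g u | u in B] ->
  exists2 h : T -> U,
    {in A, forall t, h t \in B /\ g (h t) = f t} & {in A &, injective h}.
Proof.
move=> fg.
have [I pI fI] := perm_iotaP 0%N fg.
set sA := enum A in fI; pose sB := [seq nth u0 (enum B) i | i <- I].
have psB : perm_eq sB (enum B).
  rewrite -[X in perm_eq _ X](mkseq_nth u0 (enum B)) /mkseq; apply: perm_map.
  by rewrite size_map in pI.
have sz : size sB = size sA by rewrite -(size_map f sA) [map f sA]fI !size_map.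
have gB : [seq g u | u <- sB] = [seq f t | t <- sA].
  rewrite [RHS]fI -map_comp; apply/eq_in_map => i Ii /=; rewrite (nth_map u0) //.
  by move: Ii; rewrite (perm_mem pI) mem_iota size_map.
exists (fun t => nth u0 sB (index t sA)) => [t At | t t' At At'].
  have lt : (index t sA < size sB)%N by rewrite sz index_mem mem_enum.
  split; first by rewrite -mem_enum -(perm_mem psB) mem_nth.
  by rewrite -(nth_map u0 0%N) // gB (nth_map t) -?sz // nth_index ?mem_enum.
move/eqP; rewrite nth_uniq ?sz ?index_mem ?mem_enum ?(perm_uniq psB) ?enum_uniq //.
move/eqP=> E; rewrite -(nth_index t (_ : t \in sA)) ?mem_enum // E nth_index ?mem_enum //.
Qed.

(** * Cycles and their parity when a point is inserted *)

Section CycleParity.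

Local Open Scope group_scope.

Variable T : finType.
Implicit Types (x y s : {perm T}) (a j p q : T) (S : {set T}) (b c : bool).

Lemma porbit_sub x p S :
  (forall q, q \in S -> x q \in S) -> p \in S -> porbit x p \subset S.
Proof.
move=> xS Sp; apply/subsetP=> _ /porbitP[i ->].
by elim: i => [|i IHi]; rewrite ?perm1 // expgSr permM xS.
Qed.

Lemma mem_porbitS x p q : (x q \in porbit x p) = (q \in porbit x p).
Proof. by rewrite -!eq_porbit_mem -[x q]/((x ^+ 1) q) porbit_perm. Qed.

Lemma porbit_fix x p : x p = p -> porbit x p = [set p].
Proof.
move=> xp; apply/eqP; rewrite eqEsubset sub1set porbit_id andbT.
by apply: porbit_sub => [q|]; rewrite !inE // => /eqP->; rewrite xp.
Qed.

Lemma card_porbit1 x p : (#|porbit x p| == 1%N) = (x p == p).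
Proof.
apply/idP/eqP=> [/cards1P[q xq] | /porbit_fix->]; last by rewrite cards1.
have := porbit_id x p; have: x p \in porbit x p by rewrite mem_porbitS porbit_id.
by rewrite xq !inE => /eqP-> /eqP->.
Qed.

Lemma perm_onT s : perm_on [set: T] s.
Proof. by apply/subsetP=> p; rewrite inE. Qed.

Lemma perm_onD1 S a s :
  perm_on (S :\ a) s = perm_on S s && (s a == a).
Proof.
apply/idP/andP=> [sSa | [sS /eqP sa]].
  split; first by apply: subset_trans sSa (subsetDl _ _).
  by rewrite (out_perm sSa) ?setD11.
apply/subsetP=> p sp; rewrite in_setD1 (subsetP sS) // andbT.
by apply: contraTneq sp => ->; rewrite inE sa eqxx.
Qed.

Section Insertion.

Variables (a j : T) (s : {perm T}).
Hypotheses (sa : s a = a) (ja : j != a).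

(* Permutations compose from left to right: [tperm a j * s] is [s] with [a]
   inserted just after [j]. *)
Let x := tperm a j * s.

Let xa : x a = s j. Proof. by rewrite permM tpermL. Qed.
Let xj : x j = a. Proof. by rewrite permM tpermR. Qed.
Let xE p : p != a -> p != j -> x p = s p.
Proof. by move=> pa pj; rewrite permM tpermD // eq_sym. Qed.

Lemma notin_porbit_fixed : a \notin porbit s j.
Proof. by rewrite porbit_sym porbit_fix // inE. Qed.

Lemma porbit_insert : porbit x j = a |: porbit s j.
Proof.
have jj := porbit_id x j; apply/eqP; rewrite eqEsubset; apply/andP; split.
  apply: porbit_sub => [q|]; last by rewrite inE porbit_id orbT.
  have [-> _ | qa] := eqVneq q a; first by rewrite xa inE mem_porbitS porbit_id orbT.
  have [-> _ | qj] := eqVneq q j; first by rewrite xj setU11.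
  by rewrite !inE xE // (negPf qa) mem_porbitS /= => ->; rewrite orbT.
have ax : a \in porbit x j by rewrite -xj mem_porbitS.
rewrite subUset sub1set ax; apply/subsetP=> _ /porbitP[i ->].
elim: i => [|i IHi]; first by rewrite perm1.
rewrite expgSr permM; set q := (s ^+ i) j in IHi *.
have [-> | qj] := eqVneq q j; first by rewrite -xa mem_porbitS.
rewrite -xE ?mem_porbitS //; apply: contraNneq notin_porbit_fixed => <-.
exact: mem_porbit.
Qed.

(** The orbit of [p] under [s] meets neither [a] nor [j], the only points where [x] and [s]
    differ. *)
Lemma porbit_insert_other p :
  p != a -> p \notin porbit s j -> porbit x p = porbit s p.
Proof.
move=> pa pj; suffices E i : (x ^+ i) p = (s ^+ i) p.
  by apply/setP=> q; apply/porbitP/porbitP=> -[i ->]; exists i; rewrite E.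
elim: i => // i IHi; rewrite !expgSr !permM -/x IHi -permM; apply: xE.
  apply: contraNneq pa => Ea; have: a \in porbit s p by rewrite -Ea mem_porbit.
  by rewrite porbit_sym porbit_fix // inE.
by apply: contraNneq pj => <-; rewrite porbit_sym mem_porbit.
Qed.

End Insertion.

(* Every cycle meeting [S] has odd length iff [b], except that, if [c], the cycle
   of [a] has the opposite parity; for [c = false] the point [a] plays no role. *)
Definition cycle_parity b c S a s :=
  [forall p in S, odd #|porbit s p| == b (+) (c && (p \in porbit s a))].

(** The cycle of [j] gains [a], so its parity flips while all other cycles stay. The exceptional
    cycle is now named by [j], and [c] is negated. *)
Lemma cycle_parity_insert b c S a j s :
    a \in S -> j \in S :\ a -> s a = a ->
  cycle_parity b c S a (tperm a j * s) = cycle_parity b (~~ c) (S :\ a) j s.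
Proof.
move=> Sa /setD1P[ja Sj] sa; set x := _ * s.
have xj : porbit x j = a |: porbit s j by apply: porbit_insert.
have nas := notin_porbit_fixed sa ja.
have Ea p : (p \in porbit x a) = (p \in a |: porbit s j).
  have /eqP-> : porbit x a == porbit x j by rewrite eq_porbit_mem xj setU11.
  by rewrite xj.
have xin p : p \in a |: porbit s j -> odd #|porbit x p| = ~~ odd #|porbit s j|.
  rewrite -xj -eq_porbit_mem => /eqP->; by rewrite xj cardsU1 nas.
have xout p : p \notin a |: porbit s j -> porbit x p = porbit s p.
  by rewrite !inE negb_or => /andP[pa pj]; apply: porbit_insert_other.
have sin p : p \in porbit s j -> porbit s p = porbit s j.
  by rewrite -eq_porbit_mem => /eqP.
have parE u : (~~ u == b (+) c) = (u == b (+) ~~ c) by case: u b c => [] [] [].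
apply/forall_inP/forall_inP=> H p.
  case/setD1P=> pa Sp; have := H p Sp; rewrite Ea.
  case pj: (p \in a |: _).
    rewrite xin // !andbT parE; move: pj; rewrite !inE (negPf pa) /= => pj.
    by rewrite pj sin // andbT.
  by rewrite xout ?pj //; move: pj; rewrite !inE (negPf pa) /= => ->; rewrite !andbF.
move=> Sp; rewrite Ea; case pj: (p \in a |: _).
  rewrite xin // andbT parE.
  (* All points of this cycle, [a] included, share one length, so the hypothesis at [j] settles
     them. *)
  by have := H j; rewrite !inE ja Sj porbit_id !andbT; apply.
move/negbT: pj => pj; rewrite xout //; move: pj; rewrite !inE negb_or => /andP[pa pj].
by have := H p; rewrite !inE pa Sp (negPf pj) !andbF; apply.
Qed.

(** The cycle of [a] has the odd length 1, so the condition at [a] reads [b (+) c]; no other point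
    lies in the exceptional cycle. *)
Lemma cycle_parity_fixed b c S a s :
    a \in S -> s a = a ->
  cycle_parity b c S a s = (b (+) c) && cycle_parity b false (S :\ a) a s.
Proof.
move=> Sa sa; rewrite /cycle_parity porbit_fix //.
apply/forall_inP/andP=> [H | [bc /forall_inP H] p Sp].
  split; first by have := H a Sa; rewrite porbit_fix // cards1 inE eqxx andbT => /eqP<-.
  apply/forall_inP=> p /setD1P[pa Sp]; have := H p Sp.
  by rewrite inE (negPf pa) andbF.
have [-> | pa] := eqVneq p a; first by rewrite porbit_fix // cards1 inE eqxx andbT bc.
by rewrite inE (negPf pa) andbF; apply: H; rewrite !inE pa.
Qed.

(** * Counting permutations by parity of cycle lengths *)

Definition num_parity b c S a :=
  #|[set s | perm_on S s && cycle_parity b c S a s]|.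

(* Sort the permutations [x] of [S] by the point [j = x^-1 a] preceding [a]. *)
Lemma num_parity_rec b c S a : a \in S ->
  num_parity b c S a =
    ((b (+) c) * num_parity b false (S :\ a) a
     + \sum_(j in S :\ a) num_parity b (~~ c) (S :\ a) j)%N.
Proof.
move=> Sa; rewrite /num_parity -sum1_card.
rewrite (partition_big (fun s : {perm T} => s^-1 a) (mem S)) => [|s]; last first.
  by rewrite inE => /andP[sS _]; rewrite /= (perm_closed _ (perm_onV sS)).
rewrite (big_setD1 a) //=.
(* Substituting [tperm a j * s] for the permutation turns the condition that [j] precedes [a] into
   [s a = a]. *)
have step j : j \in S ->
    \sum_(i in [set s | perm_on S s && cycle_parity b c S a s] | i^-1 a == j) 1%N
    = #|[set s | perm_on (S :\ a) s && cycle_parity b c S a (tperm a j * s)]|.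
  move=> Sj; rewrite (reindex_inj (mulgI (tperm a j))) -sum1_card /=.
  apply: eq_bigl => s; rewrite !inE perm_onD1.
  have tS : perm_on S (tperm a j).
    by apply: subset_trans (tperm_on a j) _; rewrite subUset !sub1set Sa.
  have -> : perm_on S (tperm a j * s) = perm_on S s.
    apply/idP/idP=> H; last exact: perm_onM.
    by rewrite -(tpermKg a j s); apply: perm_onM.
  have -> : ((tperm a j * s)^-1 a == j) = (s a == a).
    rewrite invMg permM tpermV (canF_eq (tpermK a j)) tpermR.
    by rewrite (canF_eq (permKV s)) eq_sym.
  by rewrite andbAC.
congr (_ + _)%N.
  rewrite step // tperm1.
  have [bc | bc] := boolP (b (+) c).
    rewrite mul1n; apply: eq_card => s; rewrite !inE mul1g perm_onD1.
    by case: eqP => [sa | ]; rewrite ?andbF ?andbT // (cycle_parity_fixed _ _ Sa sa) bc.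
  apply: eq_card0 => s; rewrite !inE mul1g perm_onD1.
  case: eqP => [sa | ]; rewrite ?andbF ?andbT //.
  by rewrite (cycle_parity_fixed _ _ Sa sa) (negPf bc) andbF.
apply: eq_bigr => j Sj; rewrite step; last by case/setD1P: Sj.
apply: eq_card => s; rewrite !inE perm_onD1.
case: eqP => [sa | ]; rewrite ?andbF // andbT.
by rewrite cycle_parity_insert.
Qed.

Lemma num_parity0 b a : num_parity b false set0 a = 1%N.
Proof.
rewrite -(cards1 (1 : {perm T})); apply: eq_card => s; rewrite !inE.
have -> : perm_on set0 s = (s == 1).
  apply/idP/eqP=> [s0 | ->]; last exact: perm_on1.
  by apply/permP=> p; rewrite (out_perm s0) ?inE ?perm1.
suff -> : cycle_parity b false set0 a s by rewrite andbT.
by apply/forall_inP=> p; rewrite inE.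
Qed.

(** Even cycles cannot cover an odd number of points, hence the value 0. Truncated subtraction and
    [dfact 0 = 1] give 1 at [n = 0], and at [n = 1] for [b] true. *)
Definition num_parityF b n :=
  if odd n then (if b then dfact n * dfact (n - 2) else 0)%N
  else (dfact (n - 1) ^ 2)%N.

Lemma dfactSS n : dfact n.+2 = (n.+2 * dfact n)%N. Proof. by []. Qed.

(** Both recurrences in one: [b] true gives the odd case, [b] false the even case. *)
Lemma num_parityFE b n :
  num_parityF b n.+2 =
    (b * num_parityF b n.+1 + n.+1 * ((~~ b + n) * num_parityF b n))%N.
Proof.
rewrite /num_parityF /= negbK.
case: n => [|[|n]]; [by case: b | by case: b |].
have oddSS : odd n.+2 = odd n by rewrite /= negbK.
rewrite oddSS !subSS !subn0 !dfactSS -!mulnn.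
move: (dfact n) (dfact n.+1) => D D'.
by case: b; case: (odd n) => /=; lia.
Qed.

(** Removing two points negates [c] twice, so only counts with [c] false remain. The fixed-point
    terms have coefficient [b] in the first round and [~~ b] in the second. *)
Lemma num_parity_rec2 b n S a :
    (forall S' a', #|S'| = n -> num_parity b false S' a' = num_parityF b n) ->
    (forall S' a', #|S'| = n.+1 ->
      num_parity b false S' a' = num_parityF b n.+1) ->
  #|S| = n.+2 -> num_parity b false S a = num_parityF b n.+2.
Proof.
move=> IH0 IH1 cS.
have [a0 Sa0] : exists a0, a0 \in S by apply/set0Pn; rewrite -card_gt0 cS.
have cD (U : {set T}) k i : i \in U -> #|U| = k.+1 -> #|U :\ i| = k.
  by move=> Ui; rewrite (cardsD1 i) Ui => -[].
have c1 := cD _ _ _ Sa0 cS.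
(* For [c] false the counts marked at [a] and at [a0] are convertible, so the marked point may be
   taken in [S]. *)
rewrite -[LHS]/(num_parity b false S a0) num_parity_rec // num_parityFE addbF IH1 //.
congr (_ + _)%N; rewrite -c1 -sum_nat_const; apply: eq_bigr => j Sj.
have c2 := cD _ _ _ Sj c1.
rewrite num_parity_rec // IH0 // addbT mulnDl; congr (_ + _)%N.
by rewrite -{1}c2 -sum_nat_const; apply: eq_bigr => i Si; rewrite IH0.
Qed.

Lemma num_parityE b S a : num_parity b false S a = num_parityF b #|S|.
Proof.
(* The recurrence has order two, so the induction carries two consecutive sizes. *)
suffices: forall n S a, (#|S| = n -> num_parity b false S a = num_parityF b n) /\
   (#|S| = n.+1 -> num_parity b false S a = num_parityF b n.+1).
  by move=> /(_ #|S| S a)[H _]; apply: H.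
move=> n; elim: n {S a} => [|n IHn] S a; last first.
  split; first by have [_] := IHn S a.
  by apply: num_parity_rec2 => S' a'; have [] := IHn S' a'.
split=> [/cards0_eq-> | /eqP/cards1P[a0 ->]]; first by rewrite num_parity0; case: b.
rewrite -[LHS]/(num_parity b false [set a0] a0) num_parity_rec ?set11 // setDv big_set0.
by rewrite num_parity0; case: b.
Qed.

(** * Conjugacy and cycle lengths *)

Lemma porbit_expgE x p (i j : nat) :
  ((x ^+ i) p == (x ^+ j) p) = (i == j %[mod #|porbit x p|]).
Proof.
set L := #|_|; have L0 : (0 < L)%N by rewrite lt0n card_porbit_neq0.
have xL1 : (x ^+ L) p = p by rewrite permX iter_porbit.
have xL k : (x ^+ (k * L)) p = p.
  by elim: k => [|k IHk]; rewrite ?perm1 // mulSn expgD permM xL1 IHk.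
(* Exponents reduce modulo [L], and the first [L] iterates of [p] are distinct. *)
have xmod k : (x ^+ k) p = nth p (traject x p L) (k %% L).
  rewrite {1}(divn_eq k L) expgD permM xL permX nth_traject ?ltn_pmod //.
by rewrite !xmod nth_uniq ?size_traject ?ltn_pmod // uniq_traject_porbit.
Qed.

Lemma porbit_conjg x y p : porbit (x ^ y) (y p) = y @: porbit x p.
Proof.
have E i : ((x ^ y) ^+ i) (y p) = y ((x ^+ i) p).
  by rewrite -conjXg conjgE !permM permK.
apply/setP=> q; apply/porbitP/imsetP=> [[i ->] | [_ /porbitP[i ->] ->]].
  by exists ((x ^+ i) p); rewrite ?E ?mem_porbit.
by exists i; rewrite E.
Qed.

Lemma perm_eq_porbits_conjg x y :
  perm_eq [seq #|pred_of_set C| | C in porbits (x ^ y)]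
          [seq #|pred_of_set C| | C in porbits x].
Proof.
have yI : injective (fun C : {set T} => y @: C) by apply: imset_inj perm_inj.
have -> : porbits (x ^ y) = (fun C : {set T} => y @: C) @: porbits x.
  apply/setP=> c; rewrite -imset_comp; apply/imsetP/imsetP=> -[p _ ->].
    by exists (y^-1 p); rewrite //= -porbit_conjg permKV.
  by exists (y p); rewrite //= porbit_conjg.
have pE : perm_eq (enum ((fun C : {set T} => y @: C) @: porbits x))
                  [seq y @: (C : {set T}) | C <- enum (porbits x)].
  apply: uniq_perm; rewrite ?enum_uniq ?map_inj_uniq ?enum_uniq // => C.
  rewrite mem_enum; apply/imsetP/mapP=> -[d xd ->]; exists d => //.
    by rewrite mem_enum.
  by rewrite mem_enum in xd.
rewrite /image_mem (perm_trans (perm_map _ pE)) // -map_comp.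
rewrite (eq_map (g := fun C : {set T} => #|C|)) // => C /=.
by rewrite card_imset //; apply: perm_inj.
Qed.

Lemma conjg_of_perm_eq_porbits x y :
  perm_eq [seq #|pred_of_set C| | C in porbits x]
          [seq #|pred_of_set C| | C in porbits y] ->
  exists z, y = x ^ z.
Proof.
case/(perm_eq_matching set0)=> h hP hI.
(* The default is never taken, since the orbit contains [p]; hence [r p] depends only on the
   cycle. *)
pose r p := odflt p [pick q in porbit x p].
have xr p : porbit x (r p) = porbit x p.
  by rewrite /r; case: pickP => //= q; rewrite -eq_porbit_mem => /eqP.
have rE p q : porbit x p = porbit x q -> r p = r q.
  by rewrite /r => ->; case: pickP => //= /(_ q); rewrite porbit_id.
have hx p : h (porbit x p) \in porbits y /\ #|h (porbit x p)| = #|porbit x p|.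
  by apply: hP; apply: imset_f.
pose r' p := odflt p [pick q in h (porbit x p)].
have yr p : porbit y (r' p) = h (porbit x p).
  have [/imsetP[q _ hq] _] := hx p; rewrite /r'; case: pickP => [q' | ] /=.
    by rewrite hq -eq_porbit_mem => /eqP.
  by move/(_ q); rewrite hq porbit_id.
have r'E p q : porbit x p = porbit x q -> r' p = r' q.
  move=> E; have := yr p; rewrite /r' E; case: pickP => //= H _.
  have [/imsetP[q' _ hq] _] := hx q; by have := H q'; rewrite hq porbit_id.
have exk p : exists k, p == (x ^+ k) (r p).
  have /porbitP[k E] : p \in porbit x (r p) by rewrite xr porbit_id.
  by exists k; apply/eqP.
(* Label each [p] as [x ^+ k p] applied to the representative [r p] of its cycle;
   conjugation sends [p] to the point of the matched cycle of [y] with label [k p]. *)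
pose k p := xchoose (exk p).
have kP p : (x ^+ k p) (r p) = p by apply/esym/eqP/(xchooseP (exk p)).
(* Matched cycles have equal length, so labels agree modulo that length on both sides. *)
have xy p (m l : nat) :
    ((x ^+ m) (r p) == (x ^+ l) (r p)) = ((y ^+ m) (r' p) == (y ^+ l) (r' p)).
  by rewrite !porbit_expgE xr yr; have [_ ->] := hx p.
pose f p := (y ^+ k p) (r' p).
have yf p : porbit y (f p) = h (porbit x p) by rewrite porbit_perm yr.
have fI : injective f.
  move=> p q fpq; have E : porbit x p = porbit x q.
    by apply: hI; rewrite ?imset_f // -!yf fpq.
  rewrite -(kP p) -(kP q) -(rE _ _ E); apply/eqP.
  by rewrite xy; apply/eqP; rewrite [RHS](_ : _ = f q) // /f (r'E _ _ E).
exists (perm fI); apply/permP=> q; rewrite conjgE !permM.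
rewrite -{1}(permKV (perm fI) q); set p := (perm fI)^-1 q; rewrite !permE.
have E : porbit x (x p) = porbit x p.
  by apply/eqP; rewrite eq_porbit_mem mem_porbitS porbit_id.
(* The labels [(k p).+1] and [k (x p)] name the same point of the cycle of [x], hence also of the
   matched cycle of [y]. *)
rewrite /f (r'E _ _ E) -permM -expgSr; apply/eqP.
by rewrite -xy -(rE _ _ E) kP expgSr permM (rE _ _ E) kP.
Qed.

End CycleParity.

Import GroupScope GRing.Theory.
Local Open Scope ring_scope.

(** * Cycle types as partitions and as class invariants *)

Section CycleType.

Variable n : nat.
Implicit Types (x y : 'S_n) (P : pred nat).

Lemma all_cycle_type P x : all P (cycle_type x) = [forall p, P #|porbit x p|].
Proof.
rewrite /cycle_type all_sort all_map; apply/allP/forallP=> [H p | H c].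
  by apply: H; rewrite mem_enum imset_f.
by rewrite mem_enum => /imsetP[p _ ->]; apply: H.
Qed.

Lemma count_cycle_type1 x : count_mem 1%N (cycle_type x) = #|[set p | x p == p]|.
Proof.
rewrite /cycle_type count_sort count_map -sum1_count big_enum_cond sum1_card.
(* Cycles of length 1 are the singletons of fixed points. *)
rewrite -(card_imset _ (@set1_inj 'I_n)); apply: eq_card => c.
rewrite [LHS]unfold_in; apply/andP/imsetP=> [[/imsetP[p _ ->]] | [p]].
  by rewrite /= card_porbit1 => /eqP xp; exists p; rewrite ?inE ?xp // porbit_fix.
by rewrite inE => /eqP xp ->; rewrite /= cards1 -(porbit_fix xp) imset_f.
Qed.

Lemma is_intpart_cycle_type x : is_intpart n (cycle_type x).
Proof.
apply/and3P; split; first by apply: sort_sorted => a b; apply: leq_total.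
  rewrite mem_sort; apply/mapP=> -[c]; rewrite mem_enum => /imsetP[p _ ->].
  by apply/eqP; rewrite eq_sym card_porbit_neq0.
rewrite (perm_sumn (s2 := [seq #|pred_of_set c| | c in porbits x])) ?perm_sort //.
rewrite sumnE big_map big_enum /=.
(* The cycles partition the points, so their sizes add up to [n]. *)
have -> : porbits x = equivalence_partition (fun p q => q \in porbit x p) [set: 'I_n].
  apply/setP=> c; apply/imsetP/imsetP=> -[p _ ->]; exists p; rewrite ?inE //.
    by apply/setP=> q; rewrite !inE.
  by apply/setP=> q; rewrite !inE.
rewrite -(card_partition (D := [set: 'I_n])) ?cardsT ?card_ord //.
apply: equivalence_partitionP.
move=> p q r _ _ _; split=> [|]; first exact: porbit_id.
by rewrite -eq_porbit_mem => /eqP->.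
Qed.

Lemma mem_class_cycle_type x y :
  (y \in x ^: [set: 'S_n])%g = (cycle_type y == cycle_type x).
Proof.
apply/imsetP/eqP=> [[z _ ->] | E].
  apply/perm_sortP; last exact: perm_eq_porbits_conjg.
  - by move=> a b; apply: leq_total.
  - by move=> a b c ba ac; apply: leq_trans ac ba.
  - by move=> a b; rewrite andbC => /anti_leq.
have [|z ->] := @conjg_of_perm_eq_porbits _ x y; last by exists z; rewrite ?inE.
by rewrite -(perm_sort geq) -/(cycle_type x) -E perm_sort.
Qed.

End CycleType.

(** * Degrees of higher Lie characters *)

Section HigherLieDegree.

Variable zeta : nat -> algC.
Hypothesis zetaP : forall i : nat, (0 < i)%N -> i.-primitive_root (zeta i).
Variable n : nat.

Lemma higherLie1 (lam : intpart n) :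
  higherLie zetaP lam 1%g = #|[set x : 'S_n | cycle_type x == lam]|%:R.
Proof.
rewrite /higherLie /higherLie_perm cfInd1 ?subsetT // lin_char1 ?omega_lin_char //.
rewrite mulr1; congr _%:R.
transitivity #|(perm_of_intpart lam ^: [set: 'S_n])%g|.
  by rewrite -index_cent1 setTI.
apply: eq_card => x.
by rewrite mem_class_cycle_type cycle_type_perm_of_intpart inE.
Qed.

(** Permutations are grouped by cycle type, each group having the size of the corresponding
    degree. *)
Lemma sum_higherLie1 (P : pred (seq nat)) :
  \sum_(lam : intpart n | P lam) higherLie zetaP lam 1%g =
    #|[set x : 'S_n | P (cycle_type x)]|%:R.
Proof.
pose type_of (x : 'S_n) := IntPart (is_intpart_cycle_type x).
rewrite -sum1_card (partition_big type_of (fun lam : intpart n => P lam)) => [|x].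
  2: by rewrite inE.
rewrite natr_sum; apply: eq_bigr => lam Plam; rewrite higherLie1 -sum1_card.
congr _%:R; apply: eq_bigl => x; rewrite !inE -val_eqE /=.
by case: eqP => [-> | ]; rewrite ?Plam ?andbF.
Qed.

End HigherLieDegree.

(** * The odd and even sides *)

Lemma card_all_parity n b :
  #|[set x : 'S_n | all (fun i => odd i == b) (cycle_type x)]| = num_parityF b n.
Proof.
(* [num_parity] takes a marked point, which ['I_0] cannot supply. *)
case: n => [|n].
  rewrite /num_parityF /= -[RHS](cards1 (1%g : 'S_0)); apply: eq_card => x.
  rewrite !inE all_cycle_type; have -> : x = 1%g by apply/permP=> -[].
  by rewrite eqxx; apply/forallP=> -[].
rewrite -[in RHS](card_ord n.+1) -cardsT -(num_parityE b _ ord0).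
apply: eq_card => x; rewrite [LHS]inE [RHS]inE perm_onT all_cycle_type /=.
apply/forallP/forall_inP=> H p; first by rewrite addbF.
by have := H p; rewrite inE addbF; apply.
Qed.

Lemma card_EP_odd n : odd n ->
  #|[set x : 'S_n | (count_mem 1%N (cycle_type x) == 1%N)
       && all [pred i : nat | (i == 1%N) || ~~ odd i] (cycle_type x)]|
    = (n * num_parityF false n.-1)%N.
Proof.
move=> n_odd; set E := [set x | _].
pose F (a : 'I_n) :=
  [set x | perm_on [set~ a] x && cycle_parity false false [set~ a] a x].
have cF a : #|F a| = num_parityF false n.-1.
  by rewrite -[LHS]/(num_parity false false [set~ a] a) num_parityE cardsC1 card_ord.
have FP (a : 'I_n) (x : 'S_n) :
    reflect (x a = a /\ forall p, p != a -> ~~ odd #|porbit x p|) (x \in F a).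
  rewrite inE -setTD perm_onD1 perm_onT /=.
  apply: (iffP andP) => -[xa H]; split=> //; try exact/eqP.
    by move=> p pa; have := forall_inP H p; rewrite !inE pa => /(_ isT)/eqP->.
  by apply/forall_inP=> p; rewrite !inE andbT => /H/negPf->.
(* Each permutation in [E] lies in exactly one [F a], [a] being its fixed point. *)
transitivity (\sum_(a < n) #|F a|)%N; last first.
  by under eq_bigr do rewrite cF; rewrite sum_nat_const card_ord.
under eq_bigr => a _ do rewrite -sum1_card big_mkcond.
(* After exchanging the sums, each [x] must lie in one [F a] if it is in [E], and in none
   otherwise. *)
rewrite exchange_big -sum1_card big_mkcond /=; apply: eq_bigr => x _.
rewrite -big_mkcond sum1_card.
have EP a : x \in F a -> x \in E /\ [set p | x p == p] = [set a].
  move=> /FP[xa H].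
  have F1 : [set p | x p == p] = [set a].
    apply/setP=> p; rewrite !inE; apply/idP/eqP=> [|->]; last exact/eqP.
    by apply: contraTeq => /H; rewrite -card_porbit1; apply: contraNneq => ->.
  split=> //; rewrite inE count_cycle_type1 F1 cards1 all_cycle_type.
  apply/forallP=> p /=; rewrite card_porbit1; have [-> | /H->] := eqVneq p a.
    by rewrite xa eqxx.
  exact: orbT.
case: ifP => [Ex | nEx]; last first.
  by symmetry; apply: eq_card0 => a; apply/negP=> /EP[]; rewrite nEx.
have := Ex; rewrite inE count_cycle_type1 all_cycle_type.
case/andP=> /cards1P[a Fa] /forallP H.
rewrite -(cards1 a) -Fa; apply: eq_card => p; symmetry.
apply/idP/idP=> [/EP[_ ->] | ]; first by rewrite set11.
rewrite Fa inE => /eqP->; apply/FP; split=> [|q qa].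
  by apply/eqP; have := set11 a; rewrite -Fa inE.
have := H q; rewrite /= card_porbit1 => /orP[xq|//]; case/negP: qa.
have: q \in [set p | x p == p] by rewrite inE.
by rewrite Fa inE.
Qed.

Theorem corollary1p5 (zeta : nat -> algC)
    (zetaP : forall i : nat, (0 < i)%N -> i.-primitive_root (zeta i))
    (n : nat) (hn : (2 <= n)%N) :
  \sum_(lam in OP n) higherLie zetaP lam 1%g =
    \sum_(lam in EP n) higherLie zetaP lam 1%g
  /\
  \sum_(lam in EP n) higherLie zetaP lam 1%g =
    (if odd n then dfact n * dfact (n - 2) else dfact (n - 1) ^ 2)%N%:R.
Proof.
set N := (RHS in _ /\ _ = RHS).
have -> : \sum_(lam in OP n) higherLie zetaP lam 1%g = N.
  under eq_bigl => lam do rewrite inE.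
  rewrite sum_higherLie1 -[N]/((num_parityF true n)%:R) -card_all_parity.
  congr _%:R; apply: eq_card => x; rewrite !inE; apply: eq_all => i.
  by rewrite eqb_id.
suffices -> : \sum_(lam in EP n) higherLie zetaP lam 1%g = N by [].
rewrite {}/N; under eq_bigl => lam do rewrite inE.
case: ifP => n_odd.
  apply: etrans (sum_higherLie1 zetaP n (fun s : seq nat =>
    (count_mem 1%N s == 1%N) && all [pred i : nat | (i == 1%N) || ~~ odd i] s)) _.
  rewrite card_EP_odd //; congr _%:R.
  (* With [n] odd, n * ((n-2)!!)^2 = n!! * (n-2)!!. *)
  case: n hn n_odd => [|[|n]] //= _ n_odd; rewrite /num_parityF /= -if_neg n_odd.
  by rewrite !subSS !subn0 mulnA.
rewrite sum_higherLie1 -[X in _ = X%:R](_ : num_parityF false n = _); last first.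
  by rewrite /num_parityF n_odd.
rewrite -card_all_parity; congr _%:R; apply: eq_card => x; rewrite !inE.
by apply: eq_all => i /=; rewrite eqbF_neg.
Qed.
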